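(* Let $k\ge 1$, $n$ and $d\ge 3$ be integers, and let $\mathbb{G}_k(n,d)$ be the class of all $k$-connected graphs of order $n$ with diameter $d$. Let $G$ be a graph in $\mathbb{G}_k(n,d)$ with maximum connective eccentricity index, i.e. $\xi^{ce}(G)\ge \xi^{ce}(G')$ for all $G'\in\mathbb{G}_k(n,d)$. Then $G\cong G(n,k,d)$ if $d$ is even, and $G\in\mathcal{H}(n,k,d)$ (up to isomorphism) if $d$ is odd.
   Context: All graphs are finite, simple and connected. For a graph $G$ and $v\in V(G)$, $d_G(v)$ is the degree of $v$ and $\varepsilon_G(v)$ is the eccentricity of $v$, i.e. the maximum distance from $v$ to a vertex of $G$. The diameter of $G$ is the maximum eccentricity of its vertices. The connective eccentricity index (CEI) of $G$ is $\xi^{ce}(G)=\sum_{v\in V(G)}\frac{d_G(v)}{\varepsilon_G(v)}$. The connectivity of $G$ is the minimum size of a set $A\subseteq V(G)$ such that $G-A$ is disconnected or has exactly one vertex; $G$ is $k$-connected if its connectivity is at least $k$. $K_m$ is the complete graph on $m$ vertices. For disjoint graphs $M_1,M_2$, the join $M_1\vee M_2$ is obtained from $M_1\cup M_2$ by adding all edges $xy$ with $x\in V(M_1)$, $y\in V(M_2)$. For $t\ge 3$ disjoint graphs, $M_1\vee M_2\vee\dots\vee M_t$ denotes the sequential join $(M_1\vee M_2)\cup(M_2\vee M_3)\cup\dots\cup(M_{t-1}\vee M_t)$ (only consecutive graphs are joined). $[t]G$ denotes the sequential join of $t$ disjoint copies of $G$; inside a longer sequential join, $[t]G$ stands for $t$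 consecutive terms equal to $G$ (and is omitted when $t=0$). For even $d\ge 4$, $$G(n,k,d)=K_1\vee[(d-2)/2]K_k\vee K_{n-kd+2k-2}\vee[(d-2)/2]K_k\vee K_1 .$$ For odd $d\ge 3$, $\mathcal{H}(n,k,d)$ is the set of all graphs $$K_1\vee[(d-3)/2]K_k\vee K_{s+1}\vee K_{t+1}\vee[(d-3)/2]K_k\vee K_1,$$ where $s,t\ge k-1$ are integers with $s+t=n-kd+3k-4$. *)

(* Defs.v *)
From mathcomp Require Import all_boot all_order all_algebra.

Set Implicit Arguments.
Unset Strict Implicit.
Unset Printing Implicit Defensive.

Record sgraph := SGraph {
  vertex :> finType;
  adj : rel vertex;
  adj_sym : symmetric adj;
  adj_irr : irreflexive adj }.

Definition iso (G H : sgraph) : Prop :=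
  exists2 f : G -> H, bijective f & forall x y, adj (f x) (f y) = adj x y.

Section Invariants.
Variable G : sgraph.

Definition deg (v : G) : nat := #|[set u | adj v u]|.

(* The least length of a walk from [x] to [y]. A shortest walk has fewer than
   #|G| edges, so the default value #|G| is returned only when there is no
   walk at all, which does not happen in a connected graph. *)
Definition dist (x y : G) : nat :=
  \big[minn/#|G|]_(m < #|G|
      | [exists p : m.-tuple G, path (@adj G) x p && (last x p == y)]) m.

Definition ecc (v : G) : nat := \max_(u : G) dist v u.

Definition diameter : nat := \max_(v : G) ecc v.

Definition cei : rat := (\sum_(v : G) (deg v)%:R / (ecc v)%:R)%R.

Definition induced_adj (S : {set G}) : rel G :=
  [rel x y | [&& x \in S, y \in S & adj x y]].

Definition disconnected (S : {set G}) : bool :=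
  [exists x in S, exists y in S, ~~ connect (induced_adj S) x y].

Definition connected : bool := (0 < #|G|) && ~~ disconnected [set: G].

Definition separating (A : {set G}) : bool :=
  disconnected (~: A) || (#|~: A| == 1).

(* In a nonempty graph the complement of a vertex is separating, so the
   default value #|G| of the minimum is never attained. *)
Definition connectivity : nat :=
  \big[minn/#|G|]_(A : {set G} | separating A) #|A|.

Definition k_connected (k : nat) : bool := k <= connectivity.

End Invariants.

Definition graph_class (k n d : nat) (G : sgraph) : Prop :=
  [/\ connected G, k_connected G k, #|G| = n & diameter G = d].

Section Complete.
Variable m : nat.

Definition complete_adj : rel 'I_m := [rel i j | i != j].

Fact complete_sym : symmetric complete_adj.
Proof. by move=> i j; rewrite /complete_adj /= eq_sym. Qed.

Fact complete_irr : irreflexive complete_adj.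
Proof. by move=> i; rewrite /complete_adj /= eqxx. Qed.

Definition complete : sgraph := SGraph complete_sym complete_irr.

End Complete.

Notation "''K_' m" := (complete m)
  (at level 8, m at level 2, format "''K_' m").

Section SequentialJoin.
Variable Ms : seq sgraph.

(* The vertices are pairs of a position [i] in [Ms] and a vertex of the [i]-th
   graph, so that repeated terms are disjoint copies. *)
Definition seqjoin_vertex : finType :=
  {i : 'I_(size Ms) & vertex (nth 'K_0 Ms i)}.

Definition seqjoin_adj : rel seqjoin_vertex :=
  fun x y : {i : 'I_(size Ms) & vertex (nth 'K_0 Ms i)} =>
    if tag x == tag y then adj (tagged x) (tagged_as x y)
    else ((tag x).+1 == tag y) || ((tag y).+1 == tag x).

Fact seqjoin_sym : symmetric seqjoin_adj.
Proof.
move=> [i x] [j y]; rewrite /seqjoin_adj /= [j == i]eq_sym.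
case: eqVneq => [eij|_]; last by rewrite orbC.
by case: _ / eij y => y; rewrite !tagged_asE; apply: adj_sym.
Qed.

Fact seqjoin_irr : irreflexive seqjoin_adj.
Proof. by case=> i x; rewrite /seqjoin_adj eqxx tagged_asE; apply: adj_irr. Qed.

Definition seqjoin : sgraph := SGraph seqjoin_sym seqjoin_irr.

End SequentialJoin.

(* The subtraction is exact on the intended range: a k-connected graph of
   order n and diameter d satisfies k * (d - 1) + 2 <= n. *)
Definition Gext (n k d : nat) : sgraph :=
  seqjoin ('K_1 :: nseq ((d - 2) %/ 2) 'K_k
           ++ 'K_(n + 2 * k - (k * d + 2))
           :: nseq ((d - 2) %/ 2) 'K_k ++ [:: 'K_1]).

(* Membership up to isomorphism; the constraint s + t = n - kd + 3k - 4 is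
   written without subtraction. *)
Definition Hext (n k d : nat) (G : sgraph) : Prop :=
  exists s t : nat,
    [/\ k - 1 <= s, k - 1 <= t, s + t + k * d + 4 = n + 3 * k
      & iso G (seqjoin ('K_1 :: nseq ((d - 3) %/ 2) 'K_k
                        ++ 'K_(s + 1) :: 'K_(t + 1)
                        :: nseq ((d - 3) %/ 2) 'K_k ++ [:: 'K_1]))].

(* Main.v *)
(* Layer G by the distance f from an end of a diametral path. Every inner layer
   is a cut, so it has at least k vertices, a vertex v has eccentricity at least
   max (f v, d - f v), and its neighbours lie in its own and the two adjacent
   layers. So the CEI of G is at most that of the sequential join of cliques
   with the same layer sizes, with equality only if G is that join.
   Write the layer sizes as b + x, where b = (1, k, ..., k, 1) and x >= 0 has
   total mass m. The CEI of the join is a constant plus a linear form in x,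
   whose coefficients are maximal exactly at the central positions, plus a
   quadratic form which is at most m^2 / ceil(d/2), a value attained by putting
   the whole mass on one central layer. Hence in an extremal graph x vanishes
   off the centre. *)
Require Import Defs.
From mathcomp Require Import all_boot all_order all_algebra.
From mathcomp Require Import ring lra zify.

Set Implicit Arguments.
Unset Strict Implicit.
Unset Printing Implicit Defensive.

Import Order.TTheory GRing.Theory Num.Theory.

(** * Layers and the optimization of their sizes *)

Definition near (i j : nat) : bool := (i <= j.+1) && (j <= i.+1).

Lemma nearC i j : near i j = near j i.
Proof. by rewrite /near andbC. Qed.

Lemma nearxx i : near i i.
Proof. by rewrite /near leqnSn. Qed.

Definition layer (T : finType) (f : T -> nat) (i : nat) : {set T} :=
  [set v | f v == i].

Section Optimum.
Variables (k d : nat).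
Hypotheses (k_gt0 : 0 < k) (d_ge3 : 3 <= d).
Local Open Scope ring_scope.

(** In a sequential join of [d + 1] nonempty cliques, [maxn i (d - i)] is the eccentricity of a
    vertex of layer [i]. *)
Definition ecc_inv (i : nat) : rat := (maxn i (d - i))%:R^-1.

(** The least layer sizes that [k]-connectivity permits: the inner layers are cuts. *)
Definition base (i : nat) : nat := if (i == 0) || (i == d) then 1%N else k.

Definition interaction (x : nat -> nat) : rat :=
  \sum_(i < d.+1) \sum_(j < d.+1)
     (x i)%:R * (x j)%:R * ((near i j)%:R * ecc_inv i).

(* The CEI of the sequential join of the complete graphs of orders
   [x 0], ..., [x d]: the first sum counts each vertex as its own neighbour. *)
Definition profile_cei (x : nat -> nat) : rat :=
  interaction x - \sum_(i < d.+1) (x i)%:R * ecc_inv i.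

(* The linear coefficient of [x i] in [profile_cei (base + x)]. *)
Definition gain (i : nat) : rat :=
  \sum_(j < d.+1) (near i j)%:R * ((base j)%:R * (ecc_inv i + ecc_inv j))
  - ecc_inv i.

Lemma profile_ceiD (x : nat -> nat) :
  profile_cei (fun i => base i + x i)%N =
  profile_cei base + \sum_(i < d.+1) (x i)%:R * gain i + interaction x.
Proof.
rewrite /profile_cei /interaction.
have -> : \sum_(i < d.+1) (x i)%:R * gain i =
   \sum_(i < d.+1) \sum_(j < d.+1)
      (x i)%:R * (base j)%:R * ((near i j)%:R * ecc_inv i)
   + \sum_(i < d.+1) \sum_(j < d.+1)
      (base i)%:R * (x j)%:R * ((near i j)%:R * ecc_inv i)
   - \sum_(i < d.+1) (x i)%:R * ecc_inv i.
  (* Swapping the sums in the second cross term collects both contributions of [x i]; hence the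
     factor [ecc_inv i + ecc_inv j] in [gain]. *)
  rewrite [X in _ + X - _]exchange_big /= -big_split -sumrB /=.
  apply: eq_bigr => i _; rewrite /gain mulrBr mulr_sumr -big_split /=.
  congr (_ - _); apply: eq_bigr => j _; rewrite [near j i]nearC; ring.
under eq_bigr => i _ do under eq_bigr => j _ do
  rewrite !natrD mulrDl !mulrDr !mulrDl.
under [X in _ - X = _]eq_bigr => i _ do rewrite natrD mulrDl.
under eq_bigr => i _ do rewrite !big_split /=.
rewrite !big_split /=; ring.
Qed.

Lemma ecc_inv_rev i : (i <= d)%N -> ecc_inv (d - i) = ecc_inv i.
Proof. by move=> le_id; rewrite /ecc_inv subKn // maxnC. Qed.

Lemma gain_rev i : (i <= d)%N -> gain (d - i) = gain i.
Proof.
move=> le_id; rewrite /gain ecc_inv_rev // (reindex_inj rev_ord_inj) /=.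
congr (_ - _); apply: eq_bigr => j _; rewrite subSS.
have le_jd : (j <= d)%N by rewrite -ltnS.
rewrite ecc_inv_rev //; congr (_%:R * (_%:R * _)).
  by rewrite /near; lia.
by rewrite /base; congr (if _ then _ else _); lia.
Qed.

Lemma near_sum i (g : nat -> rat) : (i.+2 <= d)%N ->
  \sum_(j < d.+1) (near i.+1 j)%:R * g j = g i + g i.+1 + g i.+2.
Proof.
move=> lt_id.
have hi : (i < d.+1)%N by lia.
have hi1 : (i.+1 < d.+1)%N by lia.
have hi2 : (i.+2 < d.+1)%N by lia.
rewrite (bigD1 (Ordinal hi)) //= (bigD1 (Ordinal hi1)) /=; last first.
  by rewrite -val_eqE /=; lia.
rewrite (bigD1 (Ordinal hi2)) /=; last by rewrite -!val_eqE /=; lia.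
rewrite big1 ?addr0 => [|j].
  have [-> -> ->] : [/\ near i.+1 i, near i.+1 i.+1 & near i.+1 i.+2].
    by rewrite /near; split; lia.
  by rewrite !mul1r addrA.
rewrite -!val_eqE /= => hj.
have -> : near i.+1 j = false by rewrite /near; lia.
by rewrite mul0r.
Qed.

Lemma near_sum0 (g : nat -> rat) :
  \sum_(j < d.+1) (near 0 j)%:R * g j = g 0%N + g 1%N.
Proof.
have hi : (1 < d.+1)%N by lia.
rewrite (bigD1 ord0) //= (bigD1 (Ordinal hi)) //=.
rewrite big1 ?addr0 => [|j]; first by rewrite !mul1r.
rewrite -!val_eqE /= => hj.
have -> : near 0 j = false by rewrite /near; lia.
by rewrite mul0r.
Qed.

Lemma gainS i : (i.+2 <= d)%N -> gain i.+1 =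
  (base i)%:R * (ecc_inv i.+1 + ecc_inv i)
  + (base i.+1)%:R * (ecc_inv i.+1 + ecc_inv i.+1)
  + (base i.+2)%:R * (ecc_inv i.+1 + ecc_inv i.+2) - ecc_inv i.+1.
Proof.
move=> lt_id; rewrite /gain.
by rewrite (near_sum (fun j => (base j)%:R * (ecc_inv i.+1 + ecc_inv j)) lt_id).
Qed.

Lemma gain0 : gain 0 =
  (base 0)%:R * (ecc_inv 0 + ecc_inv 0)
  + (base 1)%:R * (ecc_inv 0 + ecc_inv 1) - ecc_inv 0.
Proof.
by rewrite /gain (near_sum0 (fun j => (base j)%:R * (ecc_inv 0 + ecc_inv j))).
Qed.

Lemma ecc_inv_le i j :
  (maxn j (d - j) <= maxn i (d - i))%N -> ecc_inv i <= ecc_inv j.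
Proof.
by move=> le_ji; rewrite /ecc_inv lef_pV2 ?posrE ?ltr0n ?ler_nat //; lia.
Qed.

Lemma ecc_inv_lt i j :
  (maxn j (d - j) < maxn i (d - i))%N -> ecc_inv i < ecc_inv j.
Proof.
by move=> lt_ji; rewrite /ecc_inv ltf_pV2 ?posrE ?ltr0n ?ltr_nat //; lia.
Qed.

Lemma ecc_inv_gt0 i : 0 < ecc_inv i.
Proof. by rewrite invr_gt0 ltr0n; lia. Qed.

(** Reciprocal eccentricities grow towards the centre, so the contributions of the left, own and
    right layers can be compared one by one. Strictness comes from the own layer, whose coefficient
    [2k - 1] is positive. *)
Lemma gain_lt_half i : (i < d./2)%N -> gain i < gain d./2.
Proof.
case Ec: d./2 => [|c] // lt_ic.
have kR : 1 <= k%:R :> rat by rewrite ler1n.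
have bc2 : base c.+2 = k by rewrite /base; case: ifP => //; lia.
have bc1 : base c.+1 = k by rewrite /base; case: ifP => //; lia.
have u0 := ecc_inv_gt0 c.
have uc : ecc_inv c < ecc_inv c.+1 by apply: ecc_inv_lt; lia.
have uc2 : ecc_inv c <= ecc_inv c.+2 by apply: ecc_inv_le; lia.
have ui : ecc_inv i <= ecc_inv c by apply: ecc_inv_le; lia.
have ui1 : ecc_inv i.+1 <= ecc_inv c.+1 by apply: ecc_inv_le; lia.
rewrite gainS ?bc1 ?bc2; last by lia.
have bcR : 0 <= (base c)%:R :> rat by exact: ler0n.
have third : k%:R * (ecc_inv c + ecc_inv c.+1) <=
             k%:R * (ecc_inv c.+1 + ecc_inv c.+2).
  by apply: ler_wpM2l; lra.
have third' : k%:R * (ecc_inv i + ecc_inv i.+1) <=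
             k%:R * (ecc_inv c + ecc_inv c.+1).
  by apply: ler_wpM2l; lra.
have second : (2 * k%:R - 1) * ecc_inv c < (2 * k%:R - 1) * ecc_inv c.+1.
  by rewrite ltr_pM2l //; lra.
case: i lt_ic ui ui1 third' => [|i] lt_ic ui ui1 third'.
  (* At the end layer the own contribution is a single [ecc_inv 0], dominated because [2k - 1 >= 1];
     the absent left neighbour is compared with a nonnegative term. *)
  have b1 : base 1 = k by rewrite /base; case: ifP => //; lia.
  rewrite gain0 b1.
  have -> : base 0 = 1%N by [].
  have : 0 <= (base c)%:R * (ecc_inv c.+1 + ecc_inv c).
    by apply: mulr_ge0 => //; lra.
  have : ecc_inv c <= (2 * k%:R - 1) * ecc_inv c.
    by apply: ler_peMl; lra.
  lra.
have bc : base c = k by rewrite /base; case: ifP => //; lia.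
have bi1 : base i.+1 = k by rewrite /base; case: ifP => //; lia.
have bi2 : base i.+2 = k by rewrite /base; case: ifP => //; lia.
rewrite gainS ?bc ?bi1 ?bi2; last by lia.
have bik : (base i)%:R <= k%:R :> rat.
  by rewrite ler_nat /base; case: ifP => //; lia.
have uii : ecc_inv i <= ecc_inv c by apply: ecc_inv_le; lia.
have ui0 := ecc_inv_gt0 i; have ui10 := ecc_inv_gt0 i.+1.
have first : (base i)%:R * (ecc_inv i.+1 + ecc_inv i) <=
             k%:R * (ecc_inv c.+1 + ecc_inv c).
  by apply: ler_pM => //; lra.
have second' : (2 * k%:R - 1) * ecc_inv i.+1 <= (2 * k%:R - 1) * ecc_inv c.
  by apply: ler_wpM2l => //; lra.
lra.
Qed.

(** One position for even [d], two for odd [d]. *)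
Definition central (i : nat) : bool := (d./2 <= i <= uphalf d)%N.

Lemma gain_lt i : (i <= d)%N -> ~~ central i -> gain i < gain d./2.
Proof.
move=> le_id ncent; case: (ltnP i d./2) => [|le_ci]; first exact: gain_lt_half.
rewrite -gain_rev //; apply: gain_lt_half; move: ncent.
by rewrite /central; lia.
Qed.

Lemma gain_central i : central i -> gain i = gain d./2.
Proof.
move=> cent; have [->//|ne_i] := eqVneq i d./2.
have -> : i = (d - d./2)%N by move: cent; rewrite /central; lia.
by rewrite gain_rev //; lia.
Qed.

Lemma gain_le i : (i <= d)%N -> gain i <= gain d./2.
Proof.
move=> le_id; have [cent|/gain_lt lt] := boolP (central i).
  by rewrite gain_central.
by rewrite ltW // lt.
Qed.

(** Every [near] is at most 1 and every reciprocal eccentricity at most the central one. *)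
Lemma interaction_le x : interaction x <=
  (\sum_(i < d.+1) x i)%N%:R ^+ 2 * ecc_inv d./2.
Proof.
have -> : (\sum_(i < d.+1) x i)%N%:R ^+ 2 * ecc_inv d./2 =
    \sum_(i < d.+1) \sum_(j < d.+1) (x i)%:R * (x j)%:R * ecc_inv d./2.
  rewrite natr_sum expr2 mulr_suml mulr_suml; apply: eq_bigr => i _.
  by rewrite mulr_sumr mulr_suml.
apply: ler_sum => i _; apply: ler_sum => j _.
rewrite ler_wpM2l ?mulr_ge0 ?ler0n //.
have : ecc_inv i <= ecc_inv d./2 by apply: ecc_inv_le; move: (ltn_ord i); lia.
by have := ecc_inv_gt0 i; case: near; rewrite ?mul1r ?mul0r //; lra.
Qed.

Lemma sum_mass (m : nat) (g : nat -> rat) :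
  \sum_(i < d.+1) (if (i : nat) == d./2 then m else 0%N)%:R * g i =
  m%:R * g d./2.
Proof.
have hc : (d./2 < d.+1)%N by lia.
rewrite (bigD1 (Ordinal hc)) //= eqxx big1 ?addr0 // => i.
by rewrite -val_eqE /= => /negPf->; rewrite mul0r.
Qed.

(** With all the mass in one layer, every pair that counts is near, so the bound of [interaction_le]
    is attained. *)
Lemma profile_cei_mass (m : nat) :
  profile_cei (fun i => base i + (if i == d./2 then m else 0))%N =
  profile_cei base + m%:R * gain d./2 + m%:R ^+ 2 * ecc_inv d./2.
Proof.
rewrite profile_ceiD sum_mass /interaction; congr (_ + _).
transitivity (\sum_(i < d.+1) (if (i : nat) == d./2 then m else 0%N)%:R
                * (m%:R * ((near i d./2)%:R * ecc_inv i))).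
  apply: eq_bigr => i _.
  rewrite -(sum_mass m (fun j => (near i j)%:R * ecc_inv i)) mulr_sumr.
  by apply: eq_bigr => j _; rewrite -mulrA.
by rewrite (sum_mass m (fun i => m%:R * ((near i d./2)%:R * ecc_inv i)))
           nearxx mul1r mulrA expr2.
Qed.

(** Concentrating the mass cannot lower the linear or the quadratic part. In case of equality the
    nonnegative terms [x i * (gain d./2 - gain i)] sum to zero, so each vanishes, and off the centre
    the second factor is positive. *)
Lemma profile_cei_max (x : nat -> nat) (m := (\sum_(i < d.+1) x i)%N) :
  let best := profile_cei (fun i => base i + (if i == d./2 then m else 0))%N in
  profile_cei (fun i => base i + x i)%N <= best /\
  (best <= profile_cei (fun i => base i + x i)%N ->
   forall i, (i <= d)%N -> ~~ central i -> x i = 0%N).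
Proof.
move=> best; rewrite /best profile_cei_mass profile_ceiD.
have Q_le := interaction_le x; rewrite -/m in Q_le.
have term_ge0 (i : 'I_d.+1) : 0 <= (x i)%:R * (gain d./2 - gain i).
  by rewrite mulr_ge0 // subr_ge0 gain_le // -ltnS.
have slack : \sum_(i < d.+1) (x i)%:R * (gain d./2 - gain i) =
    m%:R * gain d./2 - \sum_(i < d.+1) (x i)%:R * gain i.
  by rewrite natr_sum mulr_suml -sumrB; apply: eq_bigr => i _; rewrite mulrBr.
have slack_ge0 : 0 <= \sum_(i < d.+1) (x i)%:R * (gain d./2 - gain i).
  by apply: sumr_ge0.
split=> [|ge_best i le_id ncent]; first by lra.
have slack0 : \sum_(j < d.+1) (x j)%:R * (gain d./2 - gain j) = 0 by lra.
have /eqP := psumr_eq0P (fun j _ => term_ge0 j) slack0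
  (i := Ordinal (le_id : (i < d.+1)%N)) isT.
by rewrite mulf_eq0 subr_eq0 pnatr_eq0 /= (gt_eqF (gain_lt le_id ncent)) orbF
  => /eqP.
Qed.

End Optimum.

(** * Sums over vertices grouped by layer *)

Section Layers.
Variables (T : finType) (f : T -> nat) (d : nat).
Hypothesis f_le : forall v, f v <= d.
Local Open Scope ring_scope.

Lemma sum_layers (g : nat -> rat) :
  \sum_v g (f v) = \sum_(i < d.+1) #|layer f i|%:R * g i.
Proof.
rewrite (partition_big (fun v => inord (f v) : 'I_d.+1) xpredT) //.
apply: eq_bigr => i _; rewrite (eq_bigr (fun=> g i)) => [|v /eqP <-]; last first.
  by rewrite inordK // ltnS.
rewrite sumr_const mulr_natl; congr (_ *+ _); apply: eq_card => v.
by rewrite inE unfold_in /= inordK // ltnS.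
Qed.

Lemma card_layers : #|T| = (\sum_(i < d.+1) #|layer f i|)%N.
Proof.
apply/eqP; rewrite -(eqr_nat rat) natr_sum.
have := sum_layers (fun=> 1); rewrite sumr_const => ->.
by apply/eqP; apply: eq_bigr => i _; rewrite mulr1.
Qed.

(** Each vertex is near itself but is not its own neighbour: this is the linear term subtracted in
    [profile_cei]. *)
Lemma sum_near :
  \sum_v #|[set u | (v != u) && near (f v) (f u)]|%:R * ecc_inv d (f v) =
  profile_cei d (fun i => #|layer f i|).
Proof.
transitivity (\sum_v ((\sum_(j < d.+1)
     #|layer f j|%:R * ((near (f v) j)%:R * ecc_inv d (f v)))
     - ecc_inv d (f v))).
  apply: eq_bigr => v _.
  rewrite -(sum_layers (fun j => (near (f v) j)%:R * ecc_inv d (f v))).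
  rewrite -mulr_suml -natr_sum -[X in _ = _ - X]mul1r -mulrBl; congr (_ * _).
  apply/eqP; rewrite eq_sym subr_eq natr1 eqr_nat eq_sym; apply/eqP.
  have -> : (\sum_u near (f v) (f u))%N = #|[set u | near (f v) (f u)]|.
    rewrite -sum1_card [RHS]big_mkcond.
    by apply: eq_bigr => u _; rewrite inE; case: near.
  rewrite [RHS](cardsD1 v) inE nearxx; congr _.+1.
  by apply: eq_card => u; rewrite !inE eq_sym.
rewrite sumrB (sum_layers (fun i => \sum_(j < d.+1)
   #|layer f j|%:R * ((near i j)%:R * ecc_inv d i))) sum_layers.
rewrite /profile_cei /interaction; congr (_ - _); apply: eq_bigr => i _.
by rewrite mulr_sumr; apply: eq_bigr => j _; rewrite mulrA.
Qed.

End Layers.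

(** * Walks, distances and separating sets *)

Section Distance.
Variable G : sgraph.
Implicit Types (x y u v : G) (p : seq G).

Lemma dist_le_size x p : path (@adj G) x p -> dist x (last x p) <= size p.
Proof.
(* A walk with at least [#|G|] edges is covered by the default value of [dist]. *)
move=> xp; case: (ltnP (size p) #|G|) => [lt_p|]; last first.
  by apply: leq_trans; rewrite /dist -minEnat -leEnat; exact: bigmin_le_id.
rewrite /dist -minEnat -leEnat; apply: (bigmin_inf (Ordinal lt_p)) => //=.
by apply/existsP; exists (in_tuple p); rewrite xp eqxx.
Qed.

Lemma dist_le_card x y : dist x y <= #|G|.
Proof. by rewrite /dist -minEnat -leEnat; exact: bigmin_le_id. Qed.

(** A function that grows by at most 1 along each edge grows by at most the length along a walk. The
    second hypothesis handles the default value of [dist]. *)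
Lemma dist_ge_lipschitz (g : G -> nat) x y :
  (forall u v, adj u v -> g v <= (g u).+1) -> g y <= g x + #|G| ->
  g y <= g x + dist x y.
Proof.
move=> lip le_card; rewrite -leq_subLR /dist -minEnat -leEnat.
apply: le_bigmin => [|m /existsP[p /andP[xp /eqP<-]]].
  by rewrite leEnat leq_subLR.
rewrite leEnat leq_subLR; have := size_tuple p; move: (tval p) xp => q xq <-.
elim: q x {le_card} xq => [|z q IHq] a /=; first by rewrite addn0.
by case/andP=> /lip az /IHq; lia.
Qed.

Lemma dist_attained x y : connected G ->
  exists2 p, path (@adj G) x p & last x p = y /\ size p = dist x y.
Proof.
case/andP=> _ /existsPn/(_ x); rewrite inE /= => /existsPn/(_ y).
rewrite inE /= negbK => /connectP[p0 xp0 Dy].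
have {xp0}: path (@adj G) x p0 by apply: sub_path xp0 => a b /and3P[].
(* A walk without repeated vertices has fewer than [#|G|] edges, so the minimum ranges over a
   nonempty set. *)
rewrite {}Dy => /shortenP[p xp /card_uniqP uniq_p _].
have lt_p : size p < #|G|.
  by rewrite -[(_ < _)]/(size (x :: p) <= #|G|) -uniq_p max_card.
rewrite /dist -minEnat.
case: (eq_bigmin (x := #|G|) (Ordinal lt_p)
  (fun m : 'I_#|G| => [exists q : m.-tuple G,
     path (@adj G) x q && (last x q == last x p)])
  (fun m : 'I_#|G| => m : nat)).
- by apply/existsP; exists (in_tuple p); rewrite xp eqxx.
- by move=> m _; rewrite leEnat ltnW.
by move=> m /existsP[q /andP[xq /eqP Dq]] ->; exists q; rewrite ?size_tuple.
Qed.

Lemma dist_adj x u v : connected G -> adj u v -> dist x v <= (dist x u).+1.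
Proof.
move=> conG; have [p xp [Du <-]] := dist_attained x u conG => uv.
have xpv : path (@adj G) x (rcons p v) by rewrite rcons_path xp Du.
by have := dist_le_size xpv; rewrite last_rcons size_rcons.
Qed.

Lemma dist_xx x : dist x x = 0.
Proof. by apply/eqP; rewrite -leqn0; apply: (@dist_le_size x [::]). Qed.

Lemma k_connected_le_card k (A : {set G}) :
  k_connected G k -> separating A -> k <= #|A|.
Proof.
move=> le_k sepA; apply: leq_trans le_k _; rewrite /connectivity -minEnat -leEnat.
by apply: (bigmin_inf A).
Qed.

End Distance.

(** * Graphs whose edges join equal or consecutive layers *)

Section Stratified.
Variables (G : sgraph) (f : G -> nat) (d : nat) (v0 w : G).
Hypothesis adj_near : forall u v, adj u v -> near (f u) (f v).
Hypothesis f_le : forall v, f v <= d.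
Hypotheses (f_v0 : f v0 = 0) (f_w : f w = d).

(** The Lipschitz bound is applied to [f] towards [w] and to [d - f] towards [v0], because [f]
    decreases on the way to [v0]. *)
Lemma ecc_ge v : d <= #|G| -> maxn (f v) (d - f v) <= ecc v.
Proof.
move=> le_dG; rewrite geq_max; apply/andP; split.
  apply: leq_trans (leq_bigmax v0).
  have := @dist_ge_lipschitz G (fun u => d - f u) v v0.
  rewrite f_v0 subn0 => le_dist; have {le_dist} : d <= d - f v + dist v v0.
    apply: le_dist => [a b /adj_near|]; last by lia.
    by rewrite /near; lia.
  by have := f_le v; lia.
apply: leq_trans (leq_bigmax w); rewrite leq_subLR -f_w.
by apply: dist_ge_lipschitz => [a b /adj_near/andP[]//|]; rewrite f_w; lia.
Qed.

(** An edge cannot jump over layer [i], so once that layer is removed the part below it is closed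
    under adjacency and cuts [v0] off from [w]. *)
Lemma layer_separating i : 0 < i < d -> separating (layer f i).
Proof.
move=> i_in; apply/orP; left; apply/existsP; exists v0.
rewrite !inE f_v0; apply/andP; split; first by lia.
apply/existsP; exists w; rewrite !inE f_w; apply/andP; split; first by lia.
have cl : closed (induced_adj (~: layer f i)) [pred v | f v < i].
  by move=> a b /and3P[]; rewrite !inE => fa fb /adj_near; rewrite /near; lia.
apply/negP => /(closed_connect cl); rewrite !inE f_v0 f_w; lia.
Qed.

End Stratified.

(** * Layered graphs, the abstract form of sequential joins of cliques *)

Definition layered (G : sgraph) (f : G -> nat) : Prop :=
  forall u v, adj u v = (u != v) && near (f u) (f v).

Section Layered.
Variables (G : sgraph) (f : G -> nat) (k d : nat).
Hypothesis layG : layered f.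
Hypothesis f_le : forall v, f v <= d.
Hypotheses (k_gt0 : 0 < k) (d_ge3 : 3 <= d).
Hypothesis layer_ge : forall i, i <= d -> base k d i <= #|layer f i|.

Lemma layer_meets (A : {set G}) i : #|A| < k -> 0 < i < d ->
  exists2 z, f z = i & z \notin A.
Proof.
move=> ltAk i_in; have /subsetPn[z] : ~~ (layer f i \subset A).
  apply/negP => /subset_leq_card; have := @layer_ge i.
  by rewrite /base; case: ifP; lia.
by rewrite inE => /eqP; exists z.
Qed.

(** Consecutive layers are fully joined, so the walk climbs through any vertex of the next layer
    outside [A]. A general [A] serves connectivity, the empty one serves distances. *)
Lemma layered_walk_up (A : {set G}) m x y :
    #|A| < k -> x \notin A -> y \notin A -> f y = f x + m.+1 ->
  exists2 p, path (induced_adj (~: A)) x p & last x p = y /\ size p = m.+1.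
Proof.
move=> ltAk; elim: m x => [|m IHm] x xA yA Dfy.
  exists [:: y] => //=; rewrite /induced_adj /= !inE xA yA layG /near andbT /=.
  by have [Exy|_] := eqVneq x y; [move: Dfy; rewrite Exy|]; lia.
have fy_le := f_le y.
have [z Dfz zA] := layer_meets (i := (f x).+1) ltAk ltac:(lia).
have [|p zp [Dy Dp]] := IHm z zA yA; first by lia.
exists (z :: p) => /=; last by rewrite Dy Dp.
rewrite zp /induced_adj /= !inE xA zA layG /near Dfz !andbT /=.
by have [Exz|_] := eqVneq x z; [move: Dfz; rewrite Exz|]; lia.
Qed.

Lemma layered_walk (A : {set G}) x y :
    #|A| < k -> x \notin A -> y \notin A -> x != y ->
  exists2 p, path (induced_adj (~: A)) x p &
    last x p = y /\ size p <= maxn 1 (maxn (f x - f y) (f y - f x)).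
Proof.
move=> ltAk xA yA ne_xy; case: (ltngtP (f x) (f y)) => [lt_xy|lt_yx|Exy].
- have [|p xp [Dy Dp]] := @layered_walk_up A (f y - (f x).+1) x y ltAk xA yA.
    by lia.
  by exists p => //; rewrite Dp; split=> //; lia.
- have [|p yp [Dx Dp]] := @layered_walk_up A (f x - (f y).+1) y x ltAk yA xA.
    by lia.
  (* The ascending walk is reversed; [belast] drops its end [x] and brings in its start [y]. *)
  exists (rev (belast y p)).
    rewrite -Dx rev_path; apply: sub_path yp => a b /and3P[aA bA ab].
    by rewrite /induced_adj /= bA aA adj_sym.
  split; last by rewrite size_rev size_belast Dp; lia.
  by case: p {yp} Dp Dx => //= a p _ _; rewrite rev_cons last_rcons.
(* Distinct vertices of one layer are adjacent, hence the [maxn 1] in the bound. *)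
exists [:: y] => //=; last by split=> //; lia.
by rewrite /induced_adj /= !inE xA yA layG ne_xy Exy nearxx.
Qed.

Lemma layered_connect (A : {set G}) : #|A| < k -> ~~ disconnected (~: A).
Proof.
move=> ltAk; apply/existsPn => x; rewrite inE; apply/nandP.
have [xA|xA] := boolP (x \in A); [by left | right].
apply/existsPn => y; rewrite inE; apply/nandP.
have [yA|yA] := boolP (y \in A); [by left | right].
rewrite negbK; have [->|ne_xy] := eqVneq x y; first exact: connect0.
have [p xp [Dy _]] := layered_walk ltAk xA yA ne_xy.
by apply/connectP; exists p.
Qed.

Lemma layered_connected : connected G.
Proof.
have [z _ _] := @layer_meets set0 1 ltac:(rewrite cards0; lia) ltac:(lia).
apply/andP; split; first by apply/card_gt0P; exists z.
by rewrite -setC0; apply: layered_connect; rewrite cards0.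
Qed.

Lemma layered_k_connected : k_connected G k.
Proof.
rewrite /k_connected /connectivity -minEnat -leEnat; apply: le_bigmin => [|A].
  apply: leq_trans (max_card (layer f 1)).
  by have := @layer_ge 1; rewrite /base; case: ifP; lia.
rewrite leEnat leqNgt; apply: contraTN => ltAk.
rewrite /separating negb_or layered_connect //=.
(* Layers 1 and 2 are both inner since [d >= 3], so at least two vertices survive. *)
have [y fy yA] := layer_meets (i := 1) ltAk ltac:(lia).
have [z fz zA] := layer_meets (i := 2) ltAk ltac:(lia).
apply/cards1P => -[t /setP Dt]; have := Dt y; have := Dt z; rewrite !inE yA zA.
by move=> /esym/eqP Ez /esym/eqP Ey; move: fy fz; rewrite Ez Ey => ->.
Qed.

Lemma layer_inhabited i : i <= d -> exists v, f v = i.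
Proof.
move=> le_id; have /card_gt0P[v] : 0 < #|layer f i|.
  by apply: leq_trans (layer_ge le_id); rewrite /base; case: ifP.
by rewrite inE => /eqP; exists v.
Qed.

Lemma layered_card_ge : d <= #|G|.
Proof.
rewrite (card_layers f_le); apply: (@leq_trans (\sum_(i < d.+1) 1)).
  by rewrite sum1_card card_ord.
apply: leq_sum => i _; apply: leq_trans (layer_ge (ltn_ord i : i <= d)).
by rewrite /base; case: ifP.
Qed.

Lemma layered_ecc v : ecc v = maxn (f v) (d - f v).
Proof.
have [v0 f0] := layer_inhabited (leq0n d); have [w fw] := layer_inhabited (leqnn d).
apply/eqP; rewrite eqn_leq; apply/andP; split; last first.
  apply: (ecc_ge _ f_le f0 fw _ layered_card_ge) => a b.
  by rewrite layG => /andP[].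
apply/bigmax_leqP => u _; have [<-|ne_vu] := eqVneq v u.
  by rewrite dist_xx.
(* Nothing is deleted here; the 1 in the length bound is absorbed because [maxn (f v) (d - f v)] is
   positive. *)
have lt0k : #|@set0 G| < k by rewrite cards0.
have [||p vp [Du le_p]] := layered_walk lt0k _ _ ne_vu; rewrite ?inE //.
rewrite -Du; apply: leq_trans (@dist_le_size _ _ _ _) _.
  by apply: sub_path vp => a b /and3P[].
by apply: leq_trans le_p _; have := f_le u; have := f_le v; lia.
Qed.

Lemma layered_diameter : diameter G = d.
Proof.
have [v0 f0] := layer_inhabited (leq0n d).
apply/eqP; rewrite eqn_leq; apply/andP; split.
  by apply/bigmax_leqP => v _; rewrite layered_ecc; have := f_le v; lia.
by apply: leq_trans (leq_bigmax v0); rewrite layered_ecc f0; lia.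
Qed.

Lemma layered_cei : cei G = profile_cei d (fun i => #|layer f i|).
Proof.
rewrite -(sum_near f_le); apply: eq_bigr => v _; rewrite layered_ecc.
congr (_%:R * _)%R; apply: eq_card => u; rewrite !inE; exact: layG.
Qed.

End Layered.

(** * Isomorphism of layered graphs with equal layer sizes *)

Section Transfer.
Variables (T T' : finType) (f : T -> nat) (g : T' -> nat) (y0 : T').
Hypothesis eq_layers : forall i, #|layer f i| = #|layer g i|.

(** Matches each layer of [f] with the same layer of [g] by rank in the enumerations. *)
Definition transfer (v : T) : T' :=
  nth y0 (enum (layer g (f v))) (index v (enum (layer f (f v)))).

Lemma index_layer_lt v :
  index v (enum (layer f (f v))) < size (enum (layer g (f v))).
Proof. by rewrite -cardE -eq_layers cardE index_mem mem_enum inE. Qed.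

Lemma transfer_layer v : g (transfer v) = f v.
Proof.
by apply/eqP; have := mem_nth y0 (index_layer_lt v); rewrite mem_enum inE.
Qed.

End Transfer.

Lemma transferK (T T' : finType) (f : T -> nat) (g : T' -> nat) x0 y0 :
    (forall i, #|layer f i| = #|layer g i|) ->
  cancel (transfer f g y0) (transfer g f x0).
Proof.
move=> eq_fg v; rewrite {1}/transfer transfer_layer //.
rewrite index_uniq ?enum_uniq ?index_layer_lt //.
by rewrite nth_index // mem_enum inE.
Qed.

(** Adjacency in a layered graph depends only on equality and layer numbers, and [transfer]
    preserves both. *)
Lemma layered_iso (G H : sgraph) (f : G -> nat) (g : H -> nat) (x0 : G) :
    layered f -> layered g -> (forall i, #|layer f i| = #|layer g i|) ->
  iso G H.
Proof.
move=> layf layg eq_fg.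
have /card_gt0P[y0 _] : 0 < #|layer g (f x0)|.
  by rewrite -eq_fg; apply/card_gt0P; exists x0; rewrite inE.
have KG := transferK x0 y0 eq_fg.
have KH := transferK y0 x0 (fun i => esym (eq_fg i)).
exists (transfer f g y0) => [|u v]; first by exists (transfer g f x0).
by rewrite layf layg !transfer_layer // (can_eq KG).
Qed.

(** * Sequential joins of complete graphs as layered graphs *)

Section CompleteJoin.
Variable ns : seq nat.

Definition complete_join : sgraph := seqjoin [seq 'K_m | m <- ns].

Definition position (x : complete_join) : nat :=
  tag (x : seqjoin_vertex [seq 'K_m | m <- ns]).

Lemma nth_complete i : nth 'K_0 [seq 'K_m | m <- ns] i = 'K_(nth 0 ns i).
Proof.
have [lt_i|le_i] := ltnP i (size ns); first exact: nth_map.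
by rewrite !nth_default ?size_map.
Qed.

Lemma adj_nth_complete i (x y : nth 'K_0 [seq 'K_m | m <- ns] i) :
  adj x y = (x != y).
Proof. by move: x y; rewrite nth_complete. Qed.

Lemma position_lt x : position x < size ns.
Proof. by rewrite -(size_map complete ns); apply: ltn_ord. Qed.

Lemma complete_join_layered : layered position.
Proof.
move=> x y; have [->|] := eqVneq x y; first by rewrite adj_irr.
case: x y => [i x] [j y]; rewrite /position /= /seqjoin_adj /= => ne_xy.
case: eqVneq => [Eij|ne_ij].
  case: _ / Eij y ne_xy => y; rewrite tagged_asE nearxx eq_Tagged /=.
  by rewrite adj_nth_complete.
have ne : nat_of_ord i <> j by move/val_inj/eqP; apply/negP.
by rewrite /near /=; lia.
Qed.

Lemma card_position i : #|layer position i| = nth 0 ns i.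
Proof.
have [lt_i|le_i] := ltnP i (size ns); last first.
  rewrite nth_default //; apply/eqP; rewrite cards_eq0; apply/eqP/setP=> x.
  by rewrite !inE; have := position_lt x; lia.
have lt_i' : i < size [seq 'K_m | m <- ns] by rewrite size_map.
pose h a : complete_join :=
  Tagged (fun j : 'I__ => vertex (nth 'K_0 [seq 'K_m | m <- ns] j))
    (a : nth 'K_0 [seq 'K_m | m <- ns] (Ordinal lt_i')).
(* The layer is the image of the clique at position [i] under the injective tagging map [h]. *)
have -> : layer position i = h @: setT.
  apply/setP => -[j y]; rewrite !inE; apply/idP/imsetP => [|[a _ ->]] //.
  rewrite /position /= => /eqP Ej.
  have {Ej} Ej : j = Ordinal lt_i' by apply: val_inj.
  by case: _ / (esym Ej) y => y; exists y.
rewrite card_imset => [|a b /eqP]; last by rewrite eq_Tagged => /eqP.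
by rewrite cardsT /= nth_complete card_ord.
Qed.

End CompleteJoin.

(** * Upper bound by the profile and its equality case *)

Lemma eq_profile_cei d (x y : nat -> nat) :
  (forall i, i <= d -> x i = y i) -> profile_cei d x = profile_cei d y.
Proof.
move=> Exy; rewrite /profile_cei /interaction; congr (_ - _)%R.
  by apply: eq_bigr => i _; apply: eq_bigr => j _; rewrite !Exy // -ltnS.
by apply: eq_bigr => i _; rewrite Exy // -ltnS.
Qed.

Section UpperBound.
Variables (G : sgraph) (f : G -> nat) (d : nat).
Hypothesis d_gt0 : 0 < d.
Hypothesis adj_near : forall u v, adj u v -> near (f u) (f v).
Hypothesis f_le : forall v, f v <= d.
Hypothesis ecc_ge : forall v, maxn (f v) (d - f v) <= ecc v.
Local Open Scope ring_scope.

Let near_nbhd v := [set u | (v != u) && near (f v) (f u)].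

Lemma nbhd_sub v : [set u | adj v u] \subset near_nbhd v.
Proof.
apply/subsetP => u; rewrite !inE => vu; rewrite adj_near // andbT.
by apply: contraTneq vu => ->; rewrite adj_irr.
Qed.

Lemma cei_term_le v :
  (deg v)%:R / (ecc v)%:R <= (deg v)%:R * ecc_inv d (f v) :> rat.
Proof.
rewrite ler_wpM2l ?ler0n // lef_pV2 ?posrE ?ltr0n ?ler_nat ?ecc_ge //;
  last by lia.
by apply: leq_trans (ecc_ge v); lia.
Qed.

Lemma near_term_le v :
  (deg v)%:R * ecc_inv d (f v) <= #|near_nbhd v|%:R * ecc_inv d (f v) :> rat.
Proof.
rewrite ler_wpM2r ?ler_nat ?subset_leq_card ?nbhd_sub // invr_ge0.
exact: ler0n.
Qed.

Lemma cei_le_profile : cei G <= profile_cei d (fun i => #|layer f i|).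
Proof.
rewrite -(sum_near f_le); apply: ler_sum => v _.
exact: le_trans (cei_term_le v) (near_term_le v).
Qed.

(** Equal totals force equality at each vertex. Cancelling the positive [ecc_inv] shows that a
    neighbourhood is as large as the set of near vertices containing it, so the two coincide. *)
Lemma cei_ge_profile_layered :
  profile_cei d (fun i => #|layer f i|) <= cei G -> layered f.
Proof.
rewrite -(sum_near f_le) => ge_cei u v.
have le_term w : true ->
    (deg w)%:R / (ecc w)%:R <= #|near_nbhd w|%:R * ecc_inv d (f w) :> rat.
  by move=> _; exact: le_trans (cei_term_le w) (near_term_le w).
have [_] := leif_sum (fun w wT => leif_eq (le_term w wT)).
rewrite eq_le ler_sum // ge_cei => /esym/forallP/(_ u)/eqP Eu.
have : #|near_nbhd u| = deg u.
  apply/eqP; rewrite eqn_leq [X in _ && X]subset_leq_card ?nbhd_sub // andbT.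
  rewrite -(ler_nat rat) -(ler_pM2r (x := ecc_inv d (f u))).
    by rewrite -Eu cei_term_le.
  by rewrite invr_gt0 ltr0n; lia.
move=> /esym/eqP; rewrite (eq_leqif (subset_leqif_cards (nbhd_sub u))).
by move=> /eqP/setP/(_ v); rewrite !inE.
Qed.

End UpperBound.

(** * Competitors and the extremal argument *)

Lemma complete_join_class (k d : nat) (ns : seq nat) :
    0 < k -> 3 <= d -> size ns = d.+1 ->
    (forall i, i <= d -> base k d i <= nth 0 ns i) ->
  graph_class k (sumn ns) d (complete_join ns) /\
  cei (complete_join ns) = profile_cei d (nth 0 ns).
Proof.
move=> k_gt0 d_ge3 sz_ns ns_ge.
have lay := @complete_join_layered ns.
have pos_le v : @position ns v <= d by rewrite -ltnS -sz_ns position_lt.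
have lay_ge i : i <= d -> base k d i <= #|layer (@position ns) i|.
  by rewrite card_position; apply: ns_ge.
split; last first.
  rewrite (layered_cei lay pos_le k_gt0 d_ge3 lay_ge).
  by apply: eq_profile_cei => i _; rewrite card_position.
split.
- exact: layered_connected lay pos_le k_gt0 d_ge3 lay_ge.
- exact: layered_k_connected lay pos_le k_gt0 d_ge3 lay_ge.
- rewrite (card_layers pos_le) sumnE (big_nth 0) sz_ns big_mkord.
  by apply: eq_bigr => i _; rewrite card_position.
exact: layered_diameter lay pos_le k_gt0 d_ge3 lay_ge.
Qed.

Lemma layered_iso_complete_join (G : sgraph) (f : G -> nat) d (ns : seq nat) :
    layered f -> (forall v, f v <= d) -> 0 < #|G| -> size ns = d.+1 ->
    (forall i, i <= d -> #|layer f i| = nth 0 ns i) ->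
  iso G (complete_join ns) /\ #|G| = sumn ns.
Proof.
move=> layf f_le /card_gt0P[x0 _] sz_ns Ens; split.
  apply: (layered_iso x0 layf (@complete_join_layered ns)) => i.
  rewrite card_position; have [/Ens //|lt_di] := leqP i d.
  rewrite nth_default ?sz_ns //; apply: eq_card0 => v; rewrite !inE.
  by have := f_le v; lia.
rewrite (card_layers f_le) sumnE (big_nth 0) sz_ns big_mkord.
by apply: eq_bigr => i _; rewrite Ens // -ltnS.
Qed.

(** A sandwich: the CEI of the concentrated join is at most that of [G], which is at most the
    profile of its layers, which is at most the CEI of that join. Equality throughout gives both the
    layered structure and the layer sizes. *)
Lemma extremal_layering (k n d : nat) (G : sgraph) :
    0 < k -> 3 <= d -> graph_class k n d G ->
    (forall G', graph_class k n d G' -> (cei G' <= cei G)%R) ->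
  exists f : G -> nat, [/\ layered f, forall v, f v <= d,
    forall i, i <= d -> base k d i <= #|layer f i|
  & forall i, i <= d -> ~~ central d i -> #|layer f i| = base k d i].
Proof.
move=> k_gt0 d_ge3 [conG kG cardG diamG] maxG.
have G_gt0 : 0 < #|G| by case/andP: conG.
have [v0 ecc_v0] := bigop.eq_bigmax (@ecc G) G_gt0.
have {ecc_v0} ecc_v0 : ecc v0 = d by rewrite -ecc_v0.
have [w dist_w] := bigop.eq_bigmax (dist v0) G_gt0.
have {dist_w} dist_w : dist v0 w = d by rewrite -dist_w.
pose f := dist v0.
have f_le v : f v <= d by rewrite -ecc_v0 leq_bigmax.
have adj_near u v : adj u v -> near (f u) (f v).
  by move=> uv; rewrite /near !dist_adj // adj_sym.
have f_v0 : f v0 = 0 := dist_xx v0.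
have layer_ge i : i <= d -> base k d i <= #|layer f i|.
  move=> le_id; rewrite /base; have [->|i_gt0] := posnP i.
    by apply/card_gt0P; exists v0; rewrite inE f_v0.
  have [->|ne_id] := eqVneq i d.
    by rewrite orbT; apply/card_gt0P; exists w; rewrite inE; apply/eqP.
  apply: k_connected_le_card kG _.
  by apply: (layer_separating adj_near f_v0 dist_w); lia.
have le_dG : d <= #|G| by rewrite -dist_w dist_le_card.
have ecc_G v : maxn (f v) (d - f v) <= ecc v.
  exact: (ecc_ge adj_near f_le f_v0 dist_w).
pose x i := #|layer f i| - base k d i.
have base_x i : i <= d -> base k d i + x i = #|layer f i|.
  by move=> /layer_ge; apply: subnKC.
pose m := \sum_(i < d.+1) x i.
(* The competitor has the same order as [G], with all excess over [base] moved to layer [d./2]. *)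
pose y i := base k d i + (if i == d./2 then m else 0).
pose ns := mkseq y d.+1.
have nth_ns i : i <= d -> nth 0 ns i = y i by move=> le_id; rewrite nth_mkseq.
have sum_ns : sumn ns = n.
  rewrite -cardG (card_layers f_le) sumnE (big_nth 0) size_mkseq big_mkord.
  rewrite (eq_bigr (fun i : 'I_d.+1 => y i)) => [|i _]; last first.
    by rewrite nth_ns // -ltnS.
  have lt_cd : d./2 < d.+1 by lia.
  have sum_mass : \sum_(i < d.+1) (if (i : nat) == d./2 then m else 0) = m.
    rewrite (bigD1 (Ordinal lt_cd)) //= eqxx big1 ?addn0 // => i.
    by rewrite -val_eqE /= => /negPf->.
  rewrite big_split /= sum_mass -big_split /=.
  by apply: eq_bigr => i _; rewrite base_x // -ltnS.
have d_gt0 : 0 < d by lia.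
have [|classJ ceiJ] := @complete_join_class k d ns k_gt0 d_ge3 (size_mkseq _ _).
  by move=> i le_id; rewrite nth_ns // leq_addr.
rewrite sum_ns in classJ.
have {classJ} := maxG _ classJ; rewrite {}ceiJ (eq_profile_cei nth_ns) => le_best.
have [le_x eq_x] := profile_cei_max k_gt0 d_ge3 x.
rewrite -/m (eq_profile_cei base_x) in le_x eq_x.
have le_G := cei_le_profile d_gt0 adj_near f_le ecc_G.
exists f; split=> // [|i le_id ncent].
  apply: (cei_ge_profile_layered d_gt0 adj_near f_le ecc_G).
  exact: le_trans le_x le_best.
have := eq_x (le_trans le_best le_G) i le_id ncent.
by have := base_x i le_id; lia.
Qed.

Theorem theorem2p1 (k n d : nat) (hk : 1 <= k) (hd : 3 <= d)
    (G : sgraph) (hG : graph_class k n d G)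
    (hmax : forall G' : sgraph, graph_class k n d G' -> (cei G' <= cei G)%R) :
  (~~ odd d -> iso G (Gext n k d)) /\ (odd d -> Hext n k d G).
Proof.
have [f [layf f_le layer_ge layer_eq]] := extremal_layering hk hd hG hmax.
have [/andP[G_gt0 _] _ cardG _] := hG.
split=> odd_d.
  set h := (d - 2) %/ 2.
  have Dd : d = h.*2.+2 by rewrite /h; lia.
  (* Only the central layer [h.+1] is not yet known; its size is recovered from the order. *)
  pose ns := 1 :: nseq h k ++ #|layer f h.+1| :: nseq h k ++ [:: 1].
  have sz_ns : size ns = d.+1.
    by rewrite /= !(size_cat, size_nseq) /= !(size_cat, size_nseq) /= Dd; lia.
  have [i le_id|isoG] :=
    @layered_iso_complete_join G f d ns layf f_le G_gt0 sz_ns.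
    have [->|ne_ih] := eqVneq i h.+1.
      by rewrite /= nth_cat size_nseq ltnn subnn.
    rewrite layer_eq //; last by rewrite /central; lia.
    rewrite /base; case: i le_id ne_ih => [|i] //= le_id ne_ih.
    rewrite nth_cat size_nseq nth_nseq; have [lt_ih|le_hi] := ltnP i h.
      by case: ifP => //; lia.
    (* The index [i] now counts from after the initial [K_1], so [i - h = 0] is the central layer,
       already excluded. *)
    case Ej: (i - h) => [|j] /=; first by lia.
    rewrite nth_cat size_nseq nth_nseq; have [lt_jh|le_hj] := ltnP j h.
      by case: ifP => //; lia.
    have -> : j - h = 0 by lia.
    by rewrite /=; case: ifP => //; lia.
  rewrite /ns /= !(sumn_cat, sumn_nseq) /= !(sumn_cat, sumn_nseq) /= cardG.
  move=> Dn.
  (* [Dn] writes [n] as the central size plus [2hk + 2], and [d = 2h + 2]. *)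
  have Ec : n + 2 * k - (k * d + 2) = #|layer f h.+1|.
    by rewrite Dn Dd -mul2n !mulnS mulnCA; lia.
  rewrite /Gext -/h Ec.
  by move: isoG; rewrite /complete_join /ns /= !(map_cat, map_nseq) /=
  !(map_cat, map_nseq).
set h := (d - 3) %/ 2.
have Dd : d = h.*2.+3 by rewrite /h; lia.
(* For [d = 2h + 3] the two layers [h.+1] and [h.+2] are central, and only their total is
   determined. *)
pose ns := 1 :: nseq h k ++ #|layer f h.+1| :: #|layer f h.+2| ::
             nseq h k ++ [:: 1].
have sz_ns : size ns = d.+1.
  by rewrite /= !(size_cat, size_nseq) /= !(size_cat, size_nseq) /= Dd; lia.
have [i le_id|isoG] :=
    @layered_iso_complete_join G f d ns layf f_le G_gt0 sz_ns.
  have [->|ne_ih] := eqVneq i h.+1.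
    by rewrite /= nth_cat size_nseq ltnn subnn.
  have [->|ne_ih1] := eqVneq i h.+2.
    by rewrite /= nth_cat size_nseq ltnNge leqnSn /= subSnn.
  rewrite layer_eq //; last by rewrite /central; lia.
  rewrite /base; case: i le_id ne_ih ne_ih1 => [|i] //= le_id ne_ih ne_ih1.
  rewrite nth_cat size_nseq nth_nseq; have [lt_ih|le_hi] := ltnP i h.
    by case: ifP => //; lia.
  case Ej: (i - h) => [|[|j]] /=; [by lia|by lia|].
  rewrite nth_cat size_nseq nth_nseq; have [lt_jh|le_hj] := ltnP j h.
    by case: ifP => //; lia.
  have -> : j - h = 0 by lia.
  by rewrite /=; case: ifP => //; lia.
rewrite /ns /= !(sumn_cat, sumn_nseq) /= !(sumn_cat, sumn_nseq) /= cardG => Dn.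
have ge1 : k <= #|layer f h.+1|.
  by apply: leq_trans (layer_ge _ _); rewrite /base; [case: ifP|]; lia.
have ge2 : k <= #|layer f h.+2|.
  by apply: leq_trans (layer_ge _ _); rewrite /base; [case: ifP|]; lia.
(* The central cliques are [K_(s+1)] and [K_(t+1)]; both layers have at least [k >= 1] vertices, so
   the subtractions are exact. *)
exists (#|layer f h.+1| - 1), (#|layer f h.+2| - 1); split; [lia|lia| |].
  by rewrite Dn Dd -mul2n !mulnS mulnCA; lia.
rewrite -/h !subnK; [|lia|lia].
by move: isoG; rewrite /complete_join /ns /= !(map_cat, map_nseq) /=
  !(map_cat, map_nseq).
Qed.
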